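(* Let $M$ be a compact Riemannian manifold. Suppose that $$1\to H\to G\to\mathbb{Z}\to 1$$ is a short exact sequence of finitely generated groups such that the induced linear automorphism $\psi^*$ of $H^1(H,\mathbb{R})$ is hyperbolic. Then there exists a neighborhood $\mathcal{U}\subseteq\operatorname{Hom}(G,\operatorname{Diff}^1(M))$ of the trivial representation such that $\rho(H)=\{1\}$ for all representations $\rho\in\mathcal{U}$.
   Context: $\operatorname{Diff}^1(M)$ is the group of $C^1$-diffeomorphisms of $M$. Fix a $C^1$ embedding $M\subset\mathbb{R}^N$ for some $N$. Norms $\|\cdot\|$ are $\ell^\infty$ norms (the maximum of absolute values of coordinates/entries for vectors and matrices; the supremum for functions). The $C^1$-metric on $\operatorname{Diff}^1(M)$ is $d(f,g)=\|f-g\|+\sup_{x\in M}\|D_xf-D_xg\|$, computed in the ambient Euclidean space. If $G$ is generated by a finite set $S$, the $C^1$-topology on $\operatorname{Hom}(G,\operatorname{Diff}^1(M))$ is the one given by the metric $d_S(\rho,\rho')=\max_{s\in S}d(\rho(s),\rho'(s))$; it does not depend on $S$. The trivial representation sends every element of $G$ to the identity map $1$ of $M$. $H^1(H,\mathbb{R})$ is the real vector space of homomorphisms $H\to\mathbb{R}$. The short exact sequence determines an outer automorphism $\psi\in\operatorname{Out}(H)$, given by the conjugation action on $H$ of a lift to $G$ of a generator of $\mathbb{Z}$, and hence a well-defined linear automorphism $\psi^*$ of $H^1(H,\mathbb{R})$. A linear automorphism of a finite-dimensional real vector space $V$ is called hyperbolic if $V\neq 0$ and every (complex) eigenvalue has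 modulus different from one; in particular, hyperbolicity of $\psi^*$ includes the requirement $H^1(H,\mathbb{R})\neq 0$. *)

(* Defs.v *)
From HB Require Import structures.
From mathcomp Require Import all_boot all_order all_algebra.
From mathcomp Require Import complex.
From mathcomp Require Import all_classical all_reals all_analysis.
Import numFieldNormedType.Exports.
Import Order.TTheory GRing.Theory Num.Theory.

Set Implicit Arguments.
Unset Strict Implicit.
Unset Printing Implicit Defensive.

Local Open Scope classical_set_scope.
Local Open Scope ring_scope.

(* Meaningful for open [U] only: differentiability and continuity at the points
   of [U] are not relative to [U]. *)
Fixpoint Ck_on (R : realType) (m : nat) (V : normedModType R) (k : nat)
    (U : set 'rV[R]_m) (f : 'rV[R]_m -> V) : Prop :=
  if k is k'.+1 then
    (forall p, U p -> differentiable f p) /\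
    (forall v, Ck_on k' U (fun p => 'D_v f p))
  else forall p, U p -> {for p, continuous f}.

(* The maps [coord i] and [param i] are total, but only their restrictions to
   [dom i] and to [coord i @` dom i], which are inverse to each other, are
   meaningful. *)
Record smooth_manifold (R : realType) (m : nat) (M : topologicalType) := {
  chart : Type;
  dom : chart -> set M;
  coord : chart -> M -> 'rV[R]_m;
  param : chart -> 'rV[R]_m -> M;
  chart_at : M -> chart;
  manifold_hausdorff : hausdorff_space M;
  manifold_second_countable : @second_countable M;
  dom_chart_at : forall x, dom (chart_at x) x;
  dom_open : forall i, open (dom i);
  chart_img_open : forall i, open (coord i @` dom i);
  coordK : forall i x, dom i x -> param i (coord i x) = x;
  coord_continuous_on : forall i x, dom i x -> {for x, continuous (coord i)};
  param_continuous_on : forall i p, (coord i @` dom i) p ->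
    {for p, continuous (param i)};
  transition_smooth : forall i j k,
    Ck_on k [set p | (coord i @` dom i) p /\ dom j (param i p)]
      (coord j \o param i) }.

Section manifold_defs.
Context {R : realType} {m : nat} {M : topologicalType}.
Variable A : smooth_manifold R m M.

Definition chart_img (i : chart A) : set 'rV[R]_m := coord i @` dom i.

(* In the chart [i], the square of the length of the tangent vector with
   coordinates [v] at [param i p] is [v *m metric i p *m v^T]. Jacobian matrices
   act on row vectors on the right, whence the shape of [metric_transition]. *)
Record riemannian_metric := {
  metric : chart A -> 'rV[R]_m -> 'M[R]_m;
  metric_sym : forall i p, chart_img i p -> (metric i p)^T = metric i p;
  metric_posdef : forall i p (v : 'rV[R]_m), chart_img i p -> v != 0 ->
    0 < (v *m metric i p *m v^T) 0 0;
  metric_smooth : forall i k, Ck_on k (chart_img i) (metric i);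
  metric_transition : forall i j p, chart_img i p -> dom j (param i p) ->
    let T := 'J (coord j \o param i) p in
    metric i p = T *m metric j (coord j (param i p)) *m T^T }.

Definition C1_map (f : M -> M) : Prop :=
  continuous f /\
  forall i j : chart A, Ck_on 1 [set p | chart_img i p /\ dom j (f (param i p))]
    (coord j \o f \o param i).

(* The third condition says that the continuous injection [iota] is a
   homeomorphism onto its image. *)
Definition C1_embedding (N : nat) (iota : M -> 'rV[R]_N) : Prop :=
  [/\ injective iota, continuous iota,
    (forall U : set M, open U -> exists2 V : set 'rV[R]_N, open V &
      U = iota @^-1` V),
    (forall i : chart A, Ck_on 1 (chart_img i) (iota \o param i)) &
    (forall (i : chart A) p, chart_img i p -> row_free ('J (iota \o param i) p))].

End manifold_defs.

Section C1_theory.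
Context {R : realType}.

Lemma differentiable_near_eq (V W : normedModType R) (f g : V -> W) (x : V) :
  (\forall y \near x, f y = g y) -> differentiable f x -> differentiable g x.
Proof.
move=> fg /diff_locallyP [dfc df].
have fgx : f x = g x by exact: nbhs_singleton fg.
have dg : g \o shift x = cst (g x) + 'd f x +o_ 0 id.
  apply/eqaddoP => e e0.
  move/eqaddoP : df => /(_ e e0).
  have : \forall h \near (0 : V), f (h + x) = g (h + x).
    by move: fg; rewrite (near_shift 0) /= subr0.
  apply: filterS2 => h /= fgh; rewrite !fctE /= => le.
  by rewrite -fgh -fgx.
by apply/diff_locallyP; rewrite (diff_unique dfc dg).
Qed.

Lemma C1_on_local (m : nat) (V : normedModType R) (U : set 'rV[R]_m)
    (f : 'rV[R]_m -> V) :
  (forall p, U p -> exists U' (g : 'rV[R]_m -> V),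
     [/\ open U', U' p, Ck_on 1 U' g & forall q, U' q -> f q = g q]) ->
  Ck_on 1 U f.
Proof.
move=> loc; split=> [p Up|v p Up]; have [U' [g [oU' U'p [dg cg] fg]]] := loc p Up.
  apply: (@differentiable_near_eq _ _ g); last exact: dg.
  have U'n : nbhs p U' by exact: open_nbhs_nbhs.
  by apply: (filterS _ U'n) => q U'q; rewrite fg.
have fgq q : U' q -> 'D_v f q = 'D_v g q.
  move=> U'q; apply: near_eq_derive.
  have U'n : nbhs q U' by exact: open_nbhs_nbhs.
  exact: (filterS _ U'n).
rewrite /prop_for /continuous_at fgq //.
apply: cvg_trans (cg v p U'p).
apply: (@near_eq_cvg _ _ (nbhs p)).
have U'n : nbhs p U' by exact: open_nbhs_nbhs.
by apply: (filterS _ U'n) => q /fgq /esym.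
Qed.

Lemma C1_on_comp (m n : nat) (V : normedModType R) (U : set 'rV[R]_m)
    (W : set 'rV[R]_n) (l : 'rV[R]_m -> 'rV[R]_n) (k : 'rV[R]_n -> V) :
  open U -> open W -> Ck_on 1 U l -> Ck_on 1 W k ->
  Ck_on 1 (U `&` l @^-1` W) (k \o l).
Proof.
move=> oU oW [dl cl] [dk ck]; split=> [p [Up Wp]|v p [Up Wp]].
  by apply: differentiable_comp; [exact: dl|exact: dk].
have Dkl q : U q -> W (l q) -> 'D_v (k \o l) q =
    \sum_(j < n) ('D_v l q) 0 j *: 'D_('e_j) k (l q).
  move=> Uq Wq; have dlq := dl q Uq; have dkq := dk _ Wq.
  rewrite deriveE; last exact: differentiable_comp.
  rewrite diff_comp //= -(deriveE v dlq).
  rewrite {1}(row_sum_delta ('D_v l q)). rewrite linear_sum.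
  by apply: eq_bigr => j _; rewrite (deriveE _ dkq) linearZ_LR.
have lp : {for p, continuous l} by exact/differentiable_continuous/dl.
have nU : nbhs p U by exact: open_nbhs_nbhs.
have nW : nbhs p (l @^-1` W).
  by apply: lp; exact: open_nbhs_nbhs.
rewrite /prop_for /continuous_at Dkl //.
apply: (@cvg_trans _ ((fun q => \sum_(j < n) ('D_v l q) 0 j *: 'D_('e_j) k (l q)) @ p)).
  apply: (@near_eq_cvg _ _ (nbhs p)).
  by apply: (filterS2 _ _ nU nW) => q Uq Wq; rewrite Dkl.
apply: (@cvg_big V _ +%R 0 xpredT _ _ (nbhs p)) => [|j _].
  by move=> /= u; exact: add_continuous.
apply: cvgZ.
  apply: (@continuous_comp _ _ _ ('D_v l) (fun r : 'rV[R]_n => r 0 j)).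
    exact: cl.
  exact: coord_continuous.
apply: (@continuous_comp _ _ _ l ('D_('e_j) k)); first exact: lp.
exact: ck.
Qed.

End C1_theory.

Section C1_map_comp.
Context {R : realType} {m : nat} {M : topologicalType}.
Variable A : smooth_manifold R m M.

Lemma open_chart_preimage (i : chart A) (f : M -> M) (D : set M) :
  continuous f -> open D ->
  open [set p | chart_img i p /\ D (f (param i p))].
Proof.
move=> cf oD; rewrite openE => p [ip Dp].
have nI : nbhs p (chart_img i) by apply: open_nbhs_nbhs; split=> //; exact: chart_img_open.
have nD : nbhs p ((f \o param i) @^-1` D).
  apply: (@continuous_comp _ _ _ (param i) f); first exact: param_continuous_on.
    exact: cf.
  exact: open_nbhs_nbhs.
by apply: (filterS2 _ _ nI nD).
Qed.

Lemma C1_map_comp (f g : M -> M) :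
  C1_map A f -> C1_map A g -> C1_map A (f \o g).
Proof.
move=> [cf df] [cg dg]; split=> [x|i j].
  by apply: continuous_comp; [exact: cg|exact: cf].
apply: C1_on_local => p [ip jp].
pose c := chart_at A (g (param i p)).
pose U := [set q | chart_img i q /\ dom c (g (param i q))].
pose W := [set q | chart_img c q /\ dom j (f (param c q))].
have oU : open U by apply: open_chart_preimage => //; exact: dom_open.
have oW : open W by apply: open_chart_preimage => //; exact: dom_open.
pose l := coord c \o g \o param i; pose k := coord j \o f \o param c.
have lW q : U q -> dom j (f (g (param i q))) -> W (l q).
  by move=> [iq cq] jq; split; [exists (g (param i q))|rewrite /l /= coordK].
have [lC kC] := (dg i c, df c j).
exists (U `&` (l @^-1` W)), (k \o l); split.
- rewrite openE => q [Uq Wq]; have nU : nbhs q U by exact: open_nbhs_nbhs.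
  have lq : {for q, continuous l}.
    by case: lC => dl _; apply/differentiable_continuous/dl.
  have nW : nbhs q (l @^-1` W) by apply: lq; exact: open_nbhs_nbhs.
  exact: (filterS2 _ _ nU nW).
- have Up : U p by split=> //; exact: dom_chart_at.
  by split=> //; exact: lW.
- exact: C1_on_comp.
- by move=> q [[iq cq] _]; rewrite /k /l /= coordK.
Qed.

Lemma C1_map_id : C1_map A id.
Proof.
split=> [x|i j]; first exact: cvg_id.
exact: (transition_smooth i j 1).
Qed.

End C1_map_comp.

Record Diff1 (R : realType) (m : nat) (M : topologicalType)
    (A : smooth_manifold R m M) := {
  diff1_fun :> M -> M;
  diff1_inv : M -> M;
  diff1_funK : cancel diff1_fun diff1_inv;
  diff1_invK : cancel diff1_inv diff1_fun;
  diff1_fun_C1 : C1_map A diff1_fun;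
  diff1_inv_C1 : C1_map A diff1_inv }.

Section Diff1_group.
Context {R : realType} {m : nat} {M : topologicalType}.
Variable A : smooth_manifold R m M.

Lemma diff1_ext (f g : Diff1 A) : diff1_fun f = diff1_fun g -> f = g.
Proof.
case: f g => [f f' fK f'K cf cf'] [g g' gK g'K cg cg'] /= fg; subst g.
have E : f' = g' by apply/funext => y; rewrite -{1}(g'K y) fK.
by subst g'; congr Build_Diff1; exact: Prop_irrelevance.
Qed.

HB.instance Definition _ := gen_eqMixin (Diff1 A).
HB.instance Definition _ := gen_choiceMixin (Diff1 A).

Definition diff1_one : Diff1 A :=
  {| diff1_fun := id; diff1_inv := id;
     diff1_funK := fun=> erefl; diff1_invK := fun=> erefl;
     diff1_fun_C1 := C1_map_id A; diff1_inv_C1 := C1_map_id A |}.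

Definition diff1_mul (f g : Diff1 A) : Diff1 A :=
  {| diff1_fun := f \o g; diff1_inv := diff1_inv g \o diff1_inv f;
     diff1_funK := can_comp (diff1_funK f) (diff1_funK g);
     diff1_invK := can_comp (diff1_invK g) (diff1_invK f);
     diff1_fun_C1 := C1_map_comp (diff1_fun_C1 f) (diff1_fun_C1 g);
     diff1_inv_C1 := C1_map_comp (diff1_inv_C1 g) (diff1_inv_C1 f) |}.

Definition diff1_opp (f : Diff1 A) : Diff1 A :=
  {| diff1_fun := diff1_inv f; diff1_inv := f;
     diff1_funK := diff1_invK f; diff1_invK := diff1_funK f;
     diff1_fun_C1 := diff1_inv_C1 f; diff1_inv_C1 := diff1_fun_C1 f |}.

Fact diff1_mulA : associative diff1_mul.
Proof. by move=> f g h; apply: diff1_ext. Qed.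
Fact diff1_mul1g : left_id diff1_one diff1_mul.
Proof. by move=> f; apply: diff1_ext. Qed.
Fact diff1_mulg1 : right_id diff1_one diff1_mul.
Proof. by move=> f; apply: diff1_ext. Qed.
Fact diff1_mulVg : left_inverse diff1_one diff1_opp diff1_mul.
Proof. by move=> f; apply/diff1_ext/funext => x /=; rewrite diff1_funK. Qed.
Fact diff1_mulgV : right_inverse diff1_one diff1_opp diff1_mul.
Proof. by move=> f; apply/diff1_ext/funext => x /=; rewrite diff1_invK. Qed.

HB.instance Definition _ := isGroup.Build (Diff1 A)
  diff1_mulA diff1_mul1g diff1_mulg1 diff1_mulVg diff1_mulgV.

End Diff1_group.

Section C1_metric.
Context {R : realType} {m N : nat} {M : topologicalType}.
Variables (A : smooth_manifold R m M) (iota : M -> 'rV[R]_N).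

(* The matrix of D_x f, where M is identified with its image in R^N, extended by
   0 on the orthogonal complement of T_x M (matrices act on row vectors on the
   right). If J is the Jacobian of a parametrization of M at x, so that T_x M is
   the row space of J, then J^T (J J^T)^-1 maps the rows of J to the standard
   basis of R^m and vanishes on the orthogonal complement of T_x M. The result
   does not depend on the chart. *)
Definition ambient_D (f : M -> M) (x : M) : 'M[R]_N :=
  let i := chart_at A x in
  let p := coord i x in
  let J := 'J (iota \o param i) p in
  J^T *m invmx (J *m J^T) *m 'J (iota \o f \o param i) p.

(* [`| _ |] is the maximum of the absolute values of the entries. Both suprema
   are finite when M is compact and nonempty; when M is empty they are -oo. *)
Definition C1_dist (f g : M -> M) : \bar R :=
  (ereal_sup [set `|iota (f x) - iota (g x)|%:E | x in [set: M]] +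
   ereal_sup [set `|ambient_D f x - ambient_D g x|%:E | x in [set: M]])%E.

Definition Hom_dist (G : groupType) (S : seq G)
    (rho rho' : {multiplicative G -> Diff1 A}) : \bar R :=
  \big[maxe/0%E]_(s <- S) C1_dist (rho s) (rho' s).

Definition Hom_neighborhood (G : groupType) (S : seq G)
    (rho0 : {multiplicative G -> Diff1 A})
    (U : set {multiplicative G -> Diff1 A}) : Prop :=
  exists2 e : R, 0 < e & [set rho | (Hom_dist S rho rho0 < e%:E)%E] `<=` U.

End C1_metric.

Definition trivial_rep (G H : groupType) : {multiplicative G -> H} :=
  @monoid.one_fun G H.

Section Groups.
Local Open Scope group_scope.

Definition generates (G : groupType) (S : seq G) : Prop :=
  forall P : set G, P 1 -> (forall x y, P x -> P y -> P (x * y)) ->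
    (forall x, P x -> P x^-1) -> (forall s, s \in S -> P s) -> forall x, P x.

Definition finitely_generated (G : groupType) : Prop :=
  exists S : seq G, generates S.

Record extension_by_Z (H G : groupType) := {
  ext_incl : {multiplicative H -> G};
  ext_proj : G -> int;
  ext_incl_inj : injective ext_incl;
  ext_projM : forall x y, ext_proj (x * y) = (ext_proj x + ext_proj y)%R;
  ext_proj_surj : forall n, exists x, ext_proj x = n;
  ext_exact : forall x, ext_proj x = 0%R <-> exists h, ext_incl h = x }.

Variables (H G : groupType) (E : extension_by_Z H G).

Lemma ext_conj_subproof (t : G) (h : H) :
  exists h', ext_incl E h' = t * ext_incl E h * t^-1.
Proof.
apply/ext_exact.
have p1 : ext_proj E 1 = 0%R.
  by apply: (@addrI _ (ext_proj E 1)); rewrite -ext_projM mulg1 addr0.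
have /ext_exact ph : exists h', ext_incl E h' = ext_incl E h by exists h.
by rewrite !ext_projM ph addr0 -ext_projM mulgV.
Qed.

Definition ext_conj (t : G) (h : H) : H := projT1 (cid (ext_conj_subproof t h)).

Lemma ext_conjE t h : ext_incl E (ext_conj t h) = t * ext_incl E h * t^-1.
Proof. exact: projT2 (cid (ext_conj_subproof t h)). Qed.

Lemma ext_conjM t : {morph ext_conj t : x y / x * y}.
Proof.
move=> x y; apply: (ext_incl_inj (e := E)).
by rewrite gmulfM !ext_conjE gmulfM !mulgA mulgVK.
Qed.

End Groups.

Section H1.
Variable R : realType.

Definition hom_pred (H : groupType) : {pred H -> R} :=
  [pred phi : H -> R | `[< forall x y, phi (x * y)%g = phi x + phi y >]].

Arguments hom_pred : clear implicits.

Record H1 (H : groupType) :=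
  { H1_fun :> H -> R; H1_hom : H1_fun \in hom_pred H }.

Section H1_lmod.
Variable H : groupType.

HB.instance Definition _ := [isSub for @H1_fun H].
HB.instance Definition _ := [Choice of H1 H by <:].

Fact hom_pred_submod : GRing.submod_closed (hom_pred H).
Proof.
split=> [|a f g /asboolP fM /asboolP gM]; apply/asboolP => x y.
  by rewrite /= addr0.
by rewrite !fctE /= fM gM scalerDr addrACA.
Qed.

HB.instance Definition _ :=
  GRing.isSubmodClosed.Build R (H -> R) (hom_pred H) hom_pred_submod.
HB.instance Definition _ := [SubChoice_isSubLmodule of H1 H by <:].

End H1_lmod.

Lemma H1M (H : groupType) (phi : H1 H) x y : phi (x * y)%g = phi x + phi y.
Proof. by case: phi => phi /= /asboolP. Qed.

Section pullback.
Variables (H G : groupType) (E : extension_by_Z H G) (t : G).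

Fact conj_pullback_subproof (phi : H1 H) :
  (phi : H -> R) \o ext_conj E t \in hom_pred H.
Proof. by apply/asboolP => x y; rewrite /= ext_conjM H1M. Qed.

Definition conj_pullback (phi : H1 H) : H1 H :=
  {| H1_fun := phi \o ext_conj E t; H1_hom := conj_pullback_subproof phi |}.

Fact conj_pullback_linear : linear conj_pullback.
Proof. by move=> a f g; apply: val_inj. Qed.

HB.instance Definition _ :=
  GRing.isLinear.Build R (H1 H) (H1 H) _ conj_pullback conj_pullback_linear.

End pullback.

Definition is_basis (V : lmodType R) (n : nat) (e : 'I_n -> V) : Prop :=
  forall v, exists! c : 'rV[R]_n, v = \sum_(i < n) c 0 i *: e i.

(* The complex eigenvalues of an endomorphism of a finite-dimensional real vector
   space are those of its matrix in a basis. *)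
Definition hyperbolic (V : lmodType R) (T : {linear V -> V}) : Prop :=
  exists (n : nat) (e : 'I_n -> V) (B : 'M[R]_n),
    [/\ (0 < n)%N, is_basis e,
      (forall i, T (e i) = \sum_(j < n) B i j *: e j) &
      (forall z : R[i], eigenvalue (map_mx (real_complex R) B) z -> `|z| != 1)].

End H1.

Arguments conj_pullback R {H G} E t.

(* Main.v *)
Require Import Defs.
From mathcomp Require Import all_boot all_order all_algebra.
From mathcomp Require Import complex.
From mathcomp Require Import ring lra.
From mathcomp Require Import all_classical all_reals all_analysis.
Set Implicit Arguments.
Unset Strict Implicit.
Unset Printing Implicit Defensive.
Import Order.TTheory GRing.Theory Num.Theory.
Import numFieldNormedType.Exports.
Local Open Scope classical_set_scope.
Local Open Scope ring_scope.

(** Write [displacement iota f x] for the vector [iota (f x) - iota x] of the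
ambient space. If [f] is C^1-close to the identity, this vector is a Lipschitz
function of [x] with a small constant [eta]
([displacement_globally_lipschitz]). In the identity

  [displacement (f \o g) x = displacement f (g x) + displacement g x]

the first term may therefore be replaced by [displacement f x], at the cost of
an error at most [eta * `|displacement g x|]: at a fixed point, displacement is
nearly additive, with an error that is small compared with the displacements
themselves. The same estimate gives, for [y] the preimage of [x] under [g], that
the displacement of [g \o h \o g^-1] at [x] is nearly that of [h] at [y].

Suppose that representations [rho n] converging to the trivial one are all
nontrivial on [H]. Among the displacements of a finite generating set [T] of
[H] over all of [M], let the largest one be attained at [x n], with norm [mu n].
Dividing displacements at [x n] by [mu n] and passing to a limit along an
ultrafilter gives a homomorphism [phi] from [H] to the real numbers
([limit_homomorphism]). It does not vanish, by normalisation. As conjugating by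
an element of [G] amounts to moving the base point, and [mu n] is the maximum
over all base points, [phi] is bounded on all the conjugates of the elements of
[T] by elements of [G]. So the forward and backward orbit of [phi] under the
automorphism of the first cohomology is bounded.

A hyperbolic automorphism has no nonzero bounded orbit
([hyperbolic_bounded_eq0]): applying linear factors of the characteristic
polynomial one at a time turns such an orbit into one on which the automorphism
is multiplication by an eigenvalue, and boundedness in both directions forces
this eigenvalue to have modulus one. *)

(** * Bounded orbits of linear maps *)

Lemma bounded_geometric_le1 (R : realType) (g : nat -> R) (s K : R) :
  0 < g 0%N -> (forall n, g n.+1 = s * g n) -> (forall n, g n <= K) -> s <= 1.
Proof.
move=> g0 gS gK; rewrite leNgt; apply/negP => s1.
have lin n : g 0%N * (1 + n%:R * (s - 1)) <= g n.
  elim: n => [|n IHn]; first by rewrite mul0r addr0 mulr1.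
  rewrite gS; apply: le_trans (ler_wpM2l (ltW (lt_trans ltr01 s1)) IHn).
  rewrite mulrCA ler_pM2l// -subr_ge0 -natr1.
  have -> : s * (1 + n%:R * (s - 1)) - (1 + (n%:R + 1) * (s - 1)) =
    n%:R * ((s - 1) * (s - 1)) by ring.
  by rewrite mulr_ge0// mulr_ge0// subr_ge0 ltW.
have d0 : 0 < g 0%N * (s - 1) by rewrite mulr_gt0// subr_gt0.
have K0 : 0 <= K / (g 0%N * (s - 1)).
  by rewrite divr_ge0 ?ltW// (lt_le_trans g0).
have := archi_boundP K0; set n := Num.bound _.
rewrite ltr_pdivrMr// => Kn.
have := le_trans (lin n) (gK n); apply/negP; rewrite -ltNge.
by apply: lt_trans Kn _; rewrite [ltRHS]mulrDr mulr1 [in ltRHS]mulrCA ltrDr.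
Qed.

Section bounded_orbits.
Context {R : realType}.
Local Notation normc := ComplexField.Normc.normc.

Let normc_ge0 (z : R[i]) : 0 <= normc z.
Proof. by case: z => a b; exact: sqrtr_ge0. Qed.

(** Orbits are indexed by [int], so that boundedness in the past is part of the
hypothesis: for [normc z < 1] only the past is unbounded. The
characteristic polynomial is applied factor by factor; the first factor
[B - z%:M] that kills the orbit obtained so far shows that this nonzero orbit is
multiplied by [z] at each step. *)
Lemma bounded_orbit_eigenvalue_norm1 (n : nat) (B : 'M[R[i]]_n)
    (w : int -> 'rV[R[i]]_n) (K : R) :
  (forall k, w (k + 1) = w k *m B) ->
  (forall k j, normc (w k 0 j) <= K) ->
  (exists k, w k != 0) ->
  exists2 z, eigenvalue B z & normc z = 1.
Proof.
case: n B w => [|n] B w wB wK wn0.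
  by case: wn0 => k; rewrite thinmx0 eqxx.
have [rs rsE] := closed_field_poly_normal (char_poly B).
have : forall k, w k *m \prod_(z <- rs) (B - z%:M) = 0.
  move=> k; have := Cayley_Hamilton B; rewrite rsE (monicP (char_poly_monic B)).
  rewrite scale1r rmorph_prod /= => E.
  suff -> : \prod_(z <- rs) (B - z%:M) = 0 by rewrite mulmx0.
  rewrite -[RHS]E; apply: eq_bigr => z _.
  by rewrite rmorphB /= horner_mx_X horner_mx_C.
elim: rs {rsE} w K wB wK wn0 => [|z rs IH] w K wB wK [k0 wk0] wrs.
  by have := wrs k0; rewrite big_nil mulmx1 => /eqP; rewrite (negPf wk0).
have [all0|] := pselect (forall k, w k *m (B - z%:M) = 0); last first.
  move=> /existsNP[k1 /eqP wk1].
  apply: (IH (fun k => w k *m (B - z%:M)) (K + normc z * K)).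
  - by move=> k; rewrite wB -!mulmxA mulmxBr mulmxBl scalar_mxC.
  - move=> k j; rewrite mulmxBr mul_mx_scalar -wB !mxE.
    apply: le_trans (le_normcD _ _) _; rewrite normcN ComplexField.Normc.normcM.
    by rewrite lerD// ler_wpM2l// normc_ge0.
  - by exists k1.
  - by move=> k; rewrite -mulmxA; have := wrs k; rewrite big_cons.
have wS k : w (k + 1) = z *: w k.
  by apply/eqP; rewrite -subr_eq0 wB -mul_mx_scalar -mulmxBr all0.
exists z.
  by apply/eigenvalueP; exists (w k0) => //; rewrite -wB wS.
have [j aj] : exists j, w k0 0 j != 0.
  by have /rV0Pn := wk0.
have a0 : 0 < normc (w k0 0 j).
  rewrite lt_neqAle normc_ge0 andbT eq_sym; apply: contra aj => /eqP.
  by move/ComplexField.Normc.eq0_normc ->.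
have nS k : normc (w (k + 1) 0 j) = normc z * normc (w k 0 j).
  by rewrite wS mxE ComplexField.Normc.normcM.
have z0 : normc z != 0.
  apply/eqP => z0; have := nS (k0 - 1); rewrite z0 mul0r subrK => E.
  by rewrite E ltxx in a0.
apply/eqP; rewrite eq_le; apply/andP; split.
  apply: (@bounded_geometric_le1 _ (fun n => normc (w (k0 + n%:Z) 0 j)) _ K).
  - by rewrite addr0.
  - by move=> i; rewrite -nS -addrA -PoszD addn1.
  - by [].
(* Backwards in time the orbit is geometric of ratio [(normc z)^-1]. *)
rewrite -invf_le1; last by rewrite lt_neqAle eq_sym z0 normc_ge0.
apply: (@bounded_geometric_le1 _ (fun n => normc (w (k0 - n%:Z) 0 j)) _ K).
- by rewrite subr0.
- move=> i; apply: (mulfI z0); rewrite mulVKf// -nS; congr (normc (w _ 0 j)).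
  by rewrite -addn1 PoszD opprD addrA subrK.
- by [].
Qed.

End bounded_orbits.

(** * Bounded classes in the first cohomology *)

Lemma multiplicative1 (G H : groupType) (f : {multiplicative G -> H}) :
  f 1%g = 1%g.
Proof. by apply: (mulgI (f 1%g)); rewrite -gmulfM !mulg1. Qed.

Section bounded_cohomology.
Variables (R : realType) (H G : groupType) (E : extension_by_Z H G).

Lemma ext_conjMl (a b : G) (h : H) :
  ext_conj E (a * b)%g h = ext_conj E a (ext_conj E b h).
Proof.
by apply: (ext_incl_inj (e := E)); rewrite !ext_conjE invgM !mulgA.
Qed.

Lemma ext_conj1 (h : H) : ext_conj E 1%g h = h.
Proof.
by apply: (ext_incl_inj (e := E)); rewrite ext_conjE invg1 mulg1 mul1g.
Qed.

Lemma H1_generated_eq0 (T : seq H) (phi : H1 R H) :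
  generates T -> (forall h, h \in T -> phi h = 0) -> forall h, phi h = 0.
Proof.
move=> gT phiT.
have phi1 : phi 1%g = 0.
  by apply: (@addrI _ (phi 1%g)); rewrite -H1M mulg1 addr0.
apply: gT => // [x y px py|x px]; first by rewrite H1M px py addr0.
by apply: (@addrI _ (phi x)); rewrite -H1M mulgV px addr0.
Qed.

Lemma H1_sumE (n : nat) (e : 'I_n -> H1 R H) (c : 'rV[R]_n) (h : H) :
  (\sum_(i < n) c 0 i *: e i : H1 R H) h = \sum_(i < n) c 0 i * e i h.
Proof.
pose ev (phi : H1 R H) := phi h.
have evD : {morph ev : x y / x + y} by [].
have ev0 : ev 0 = 0 by [].
by rewrite -[LHS]/(ev _) (big_morph ev evD ev0).
Qed.

Definition bounded_under_conj (T : seq H) (K : R) (phi : H1 R H) :=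
  forall g h, h \in T -> `|phi (ext_conj E g h)| <= K.

Lemma bounded_under_conj_pullback (T : seq H) (K : R) (phi : H1 R H) (a : G) :
  bounded_under_conj T K phi -> bounded_under_conj T K (conj_pullback R E a phi).
Proof. by move=> bphi g h hT /=; rewrite -ext_conjMl; exact: bphi. Qed.

(** Evaluation on the generators [T] is a linear injection of the finite
dimensional cohomology, so a bound on [T] bounds the coordinates of all the
iterates of [phi] in a basis; these coordinates form an orbit of the matrix [B],
to which [bounded_orbit_eigenvalue_norm1] applies over the complex numbers. *)
Lemma hyperbolic_bounded_eq0 (t : G) (T : seq H) (K : R) (phi : H1 R H) :
  generates T -> hyperbolic (conj_pullback R E t) ->
  bounded_under_conj T K phi -> forall h, phi h = 0.
Proof.
move=> gT [n [e [B [n0 eb eB hyp]]]] bphi h; apply: contrapT => phih.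
pose orb (k : int) : H1 R H := match k with
  | Posz i => iter i (conj_pullback R E t) phi
  | Negz i => iter i.+1 (conj_pullback R E (t^-1)%g) phi end.
have pullK (f : H1 R H) :
    conj_pullback R E t (conj_pullback R E (t^-1)%g f) = f.
  by apply: val_inj; apply/funext => x /=; rewrite -ext_conjMl mulVg ext_conj1.
have orbS k : orb (k + 1) = conj_pullback R E t (orb k).
  case: k => [i|[|i]].
  - by rewrite -PoszD addn1.
  - by rewrite /= pullK.
  - have -> : Negz i.+1 + 1 = Negz i by rewrite !NegzE -addn1 PoszD opprD subrK.
    by rewrite [orb (Negz i.+1)]/= pullK.
have orbB k : bounded_under_conj T K (orb k).
  by case: k => i; elim: i => [|i IHi] //=; exact: bounded_under_conj_pullback.
have cP v : {c : 'rV[R]_n | v = \sum_(i < n) c 0 i *: e i}.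
  by apply: cid; have [c [cE _]] := eb v; exists c.
pose c v := projT1 (cP v); have cE v : v = \sum_(i < n) c v 0 i *: e i.
  exact: projT2 (cP v).
have cU v (u : 'rV[R]_n) : v = \sum_(i < n) u 0 i *: e i -> c v = u.
  by move=> vu; have [d [_ dU]] := eb v; rewrite -(dU _ (cE v)) -(dU _ vu).
have cS v : c (conj_pullback R E t v) = c v *m B.
  apply: cU; rewrite [in LHS](cE v) linear_sum /=.
  under eq_bigr do rewrite linearZ /= eB scaler_sumr.
  rewrite exchange_big /=; apply: eq_bigr => j _; rewrite mxE scaler_suml.
  by apply: eq_bigr => i _; rewrite scalerA.
pose V := \matrix_(i < n, l < size T) e i (nth 1%g T l).
have cV v l : (c v *m V) 0 l = v (nth 1%g T l).
  by rewrite [in RHS](cE v) H1_sumE mxE; apply: eq_bigr => i _; rewrite mxE.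
have fV : row_free V.
  apply/inj_row_free => u uV.
  have u0 : (\sum_(i < n) u 0 i *: e i : H1 R H) = 0.
    apply: val_inj; apply/funext; apply: (H1_generated_eq0 gT) => x xT.
    have xl : (index x T < size T)%N by rewrite index_mem.
    have /rowP/(_ (Ordinal xl)) := uV; rewrite !mxE => uVl; rewrite H1_sumE -[RHS]uVl.
    by apply: eq_bigr => i _; rewrite mxE /= nth_index.
  rewrite -(cU _ _ (esym u0)); apply: cU.
  by rewrite big1// => i _; rewrite mxE scale0r.
(* A left inverse of the evaluation matrix recovers coordinates from values. *)
have cB k j : `|c (orb k) 0 j| <= \sum_j \sum_l K * `|pinvmx V l j|.
  rewrite -[c _](mulmxKp fV) mxE.
  have K0 l : `|(c (orb k) *m V) 0 l| <= K.
    by rewrite cV -[nth _ _ _]ext_conj1 orbB// mem_nth.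
  have K00 (l : 'I_(size T)) : 0 <= K by apply: le_trans (K0 l).
  rewrite [leRHS](bigD1 j) //=; apply: ler_wpDr.
    by apply: sumr_ge0 => ? _; apply: sumr_ge0 => l _; rewrite mulr_ge0 ?K00.
  apply: le_trans (ler_norm_sum _ _ _) _; apply: ler_sum => l _.
  by rewrite normrM ler_wpM2r.
pose w k := map_mx (real_complex R) (c (orb k)).
have [|k j||z /hyp zn1 z1] :=
    @bounded_orbit_eigenvalue_norm1 R n (map_mx (real_complex R) B) w
      (\sum_j \sum_l K * `|pinvmx V l j|).
- by move=> k; rewrite /w orbS cS map_mxM.
- by rewrite mxE /ComplexField.Normc.normc /= expr0n addr0 sqrtr_sqr.
- exists 0; apply/eqP => w0; apply: phih.
  have c0 : c phi = 0.
    apply/rowP => j; have /rowP/(_ j) := w0; rewrite !mxE => -[] //.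
  by rewrite (cE phi) H1_sumE big1// => i _; rewrite c0 mxE mul0r.
- move/negP: zn1; apply; apply/eqP.
  rewrite -[RHS](rmorph1 (real_complex R)) -z1; by case: (z).
Qed.

End bounded_cohomology.

(** * Matrix norms and the mean value inequality *)

Section matrix_norm.
Context {R : realType}.

Lemma mx_entry_le_norm (m n : nat) (A : 'M[R]_(m, n)) i j : `|A i j| <= `|A|.
Proof.
rewrite [leRHS]/Num.norm /= mx_normrE.
exact: (le_bigmax _ (fun ij => `|A ij.1 ij.2|) (i, j)).
Qed.

Lemma mx_norm_le (m n : nat) (A : 'M[R]_(m, n)) (K : R) :
  0 <= K -> (forall i j, `|A i j| <= K) -> `|A| <= K.
Proof.
by move=> K0 AK; rewrite [leLHS]/Num.norm /= mx_normrE bigmax_le// => -[i j] _.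
Qed.

Lemma mulmx_norm_le (m n p : nat) (A : 'M[R]_(m, n)) (B : 'M[R]_(n, p)) :
  `|A *m B| <= n%:R * `|A| * `|B|.
Proof.
apply: mx_norm_le => [|i j]; first by rewrite !mulr_ge0.
rewrite mxE; apply: le_trans (ler_norm_sum _ _ _) _.
have -> : n%:R * `|A| * `|B| = \sum_(k < n) `|A| * `|B|.
  by rewrite sumr_const card_ord -mulrA mulr_natl.
by apply: ler_sum => k _; rewrite normrM ler_pM ?mx_entry_le_norm.
Qed.

(** Over an ordered field, [v *m J *m J^T = 0] makes the squared length of
[v *m J] vanish. This is what makes [ambient_D] recover derivatives in charts. *)
Lemma gram_unitmx (m n : nat) (J : 'M[R]_(m, n)) :
  row_free J -> J *m J^T \in unitmx.
Proof.
move=> fJ; rewrite -row_free_unit; apply/inj_row_free => v vJJ.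
apply: (row_free_inj fJ); rewrite mul0mx; apply/rowP => j; rewrite [RHS]mxE.
have : ((v *m J) *m (v *m J)^T) 0 0 = 0.
  by rewrite trmx_mul mulmxA -(mulmxA v) vJJ mul0mx mxE.
rewrite mxE => /eqP; rewrite psumr_eq0; last first.
  by move=> k _; rewrite [_^T _ _]mxE -expr2 sqr_ge0.
by move=> /allP/(_ j (mem_index_enum j))/=; rewrite [_^T _ _]mxE mulf_eq0 orbb => /eqP.
Qed.

End matrix_norm.

Section mean_value.
Context {R : realType}.

Lemma is_derive_line (V : normedModType R) (f : V -> R) (a v : V) (s : R) :
  derivable f (a + s *: v) v ->
  is_derive s 1 (fun s : R => f (a + s *: v)) ('D_v f (a + s *: v)).
Proof.
move=> df.
have E : (fun h : R => h^-1 *: (((fun s : R => f (a + s *: v)) \o shift s) (h *: 1)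
      - f (a + s *: v))) =
    (fun h : R => h^-1 *: ((f \o shift (a + s *: v)) (h *: v)
      - f (a + s *: v))).
  apply/funext => h /=; congr (_ *: (f _ - _)).
  by rewrite [h *: 1]mulr1 scalerDl addrCA.
by apply: DeriveDef; rewrite /derivable /derive E.
Qed.

(** On the segment each coordinate is a function of one variable, and the norm is
the largest coordinate, so the classical mean value theorem loses no constant. *)
Lemma mean_value_inequality (V : normedModType R) (n : nat)
    (F : V -> 'rV[R]_n) (a b : V) (C : R) :
  (forall s : R, 0 <= s <= 1 -> differentiable F (a + s *: (b - a))) ->
  (forall s : R, 0 <= s <= 1 -> `|'D_(b - a) F (a + s *: (b - a))| <= C) ->
  `|F b - F a| <= C.
Proof.
set v := b - a => dF DF.
have C0 : 0 <= C by apply: le_trans (DF 0 _); rewrite ?lexx ?ler01.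
apply: mx_norm_le => // i j; rewrite (ord1 i) {i}.
pose f p : R := F p 0 j.
have ds (s : R) : 0 <= s <= 1 -> derivable F (a + s *: v) v.
  by move=> s01; apply: diff_derivable; exact: dF.
have dfs (s : R) : 0 <= s <= 1 ->
    is_derive s 1 (fun s : R => f (a + s *: v)) ('D_v f (a + s *: v)).
  by move=> s01; apply: is_derive_line; have /derivable_mxP := ds s s01; exact.
have [||c c01] := @MVT_segment R (fun s : R => f (a + s *: v))
  (fun s : R => 'D_v f (a + s *: v)) 0 1 ler01.
- by move=> s; rewrite in_itv /= => /andP[s0 s1]; apply: dfs; rewrite !ltW.
- apply: derivable_within_continuous => s; rewrite in_itv /= => s01.
  by case: (dfs s s01).
rewrite subr0 mulr1 scale1r scale0r addr0 => E.
move: c01 E; rewrite in_itv /= => c01; have -> : a + v = b by rewrite /v addrC subrK.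
move=> E.
rewrite !mxE -/(f b) -/(f a) E; apply: le_trans (DF c c01).
apply: le_trans (mx_entry_le_norm _ 0 j).
by rewrite (derive_mx (ds c c01)) mxE.
Qed.

End mean_value.

(** * Local estimates in a chart *)

Lemma ball_segment (R : realType) (m : nat) (p0 p q : 'rV[R]_m) (r s : R) :
  ball p0 r p -> ball p0 r q -> 0 <= s <= 1 -> ball p0 r (p + s *: (q - p)).
Proof.
rewrite -!ball_normE /= => pB qB /andP[s0 s1].
have -> : p0 - (p + s *: (q - p)) = (1 - s) *: (p0 - p) + s *: (p0 - q).
  by apply/rowP => j; rewrite !mxE; ring.
apply: le_lt_trans (ler_normD _ _) _; rewrite !normrZ.
rewrite (ger0_norm s0) ger0_norm ?subr_ge0//.
have [->|s1'] := eqVneq s 1; first by rewrite subrr mul0r add0r mul1r.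
have s1'' : 0 < 1 - s by rewrite subr_gt0 lt_neqAle s1' s1.
have -> : r = (1 - s) * r + s * r by rewrite mulrBl mul1r subrK.
by rewrite ltr_leD// ?ltr_pM2l// ler_wpM2l// ltW.
Qed.

Section local_immersion.
Context {R : realType} {m N : nat}.
Variables (U : set 'rV[R]_m) (P : 'rV[R]_m -> 'rV[R]_N) (p0 : 'rV[R]_m).
Hypotheses (oU : open U) (PC1 : Ck_on 1 U P) (Up0 : U p0).

(** Continuity of the finitely many partial derivatives gives continuity of the
derivative, uniformly in the direction [v]. *)
Lemma C1_derive_near (e : R) : 0 < e ->
  \forall p \near p0, U p /\ forall v, `|'D_v P p - 'D_v P p0| <= e * `|v|.
Proof.
move=> e0; have [dP cP] := PC1.
pose e' := e / m.+1%:R; have e'0 : 0 < e' by rewrite divr_gt0.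
have DvE p v : U p -> 'D_v P p = \sum_(j < m) v 0 j *: 'D_('e_j) P p.
  move=> Up; have dPp := dP p Up.
  rewrite (deriveE _ dPp) {1}(row_sum_delta v) linear_sum.
  by apply: eq_bigr => j _; rewrite (deriveE _ dPp) linearZ_LR.
have near_e : \forall p \near p0,
    forall j : 'I_m, `|'D_('e_j) P p - 'D_('e_j) P p0| <= e'.
  apply: (@filter_forall _ _ (fun j p => `|'D_('e_j) P p - 'D_('e_j) P p0| <= e')
    (nbhs p0) _) => j.
  have /cvgrPdist_le/(_ e' e'0) := cP 'e_j p0 Up0.
  by apply: filterS => p De; rewrite distrC; exact: De.
have nU : nbhs p0 U by exact: open_nbhs_nbhs.
apply: filterS2 nU near_e => p Up De; split=> // v.
rewrite !DvE// -sumrB; apply: le_trans (ler_norm_sum _ _ _) _.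
apply: (@le_trans _ _ (\sum_(j < m) `|v| * e')).
  apply: ler_sum => j _; rewrite -scalerBr normrZ.
  by rewrite ler_pM// mx_entry_le_norm.
rewrite sumr_const card_ord -mulrnAr mulrC ler_wpM2r//.
by rewrite -mulr_natl /e' mulrCA ler_piMr ?(ltW e0)// ler_pdivrMr// mul1r ler_nat.
Qed.

(** Near [p0] the map [P] differs from its differential at [p0] by a map with an
arbitrarily small Lipschitz constant, and the differential is bounded below
because it is injective. The lower bound compares distances in the chart with
the ambient distance; the upper bound on derivatives is what turns bounds on
[ambient_D] into bounds in the chart. *)
Lemma immersion_local_bilipschitz : row_free ('J P p0) ->
  exists r c K : R, [/\ 0 < r, 0 <= c, ball p0 r `<=` U,
    (forall p q, ball p0 r p -> ball p0 r q -> `|q - p| <= c * `|P q - P p|) &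
    (forall p v, ball p0 r p -> `|'D_v P p| <= K * `|v|)].
Proof.
move=> fJ; have [dP _] := PC1; have dP0 := dP p0 Up0.
pose Q := pinvmx ('J P p0).
pose k := N%:R * `|Q| + 1.
have k0 : 0 < k by rewrite ltr_wpDl// mulr_ge0.
have vk v : `|v| <= k * `|'d P p0 v|.
  rewrite -(deriveE v dP0) deriveEjacobian// -{1}[v](mulmxKp fJ).
  apply: le_trans (mulmx_norm_le _ _) _; rewrite mulrAC ler_wpM2r//.
  by rewrite lerDl.
(* Half of the lower bound [k^-1] of the differential is given up. *)
pose e := (2 * k)^-1; have e0 : 0 < e by rewrite invr_gt0 mulr_gt0.
have /nbhs_ballP[r r0 rP] := C1_derive_near e0.
have Jb v : `|'d P p0 v| <= (m%:R * `|'J P p0|) * `|v|.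
  rewrite -(deriveE v dP0) deriveEjacobian//.
  by apply: le_trans (mulmx_norm_le _ _) _; rewrite mulrAC.
exists r, (2 * k), (e + m%:R * `|'J P p0|); split=> //.
- by rewrite mulr_ge0// ltW.
- by move=> p /rP[].
- move=> p q pB qB.
  have seg (s : R) := ball_segment pB qB (s := s).
  have dlin x : differentiable ('d P p0 : 'rV[R]_m -> 'rV[R]_N) x.
    exact/linear_differentiable/diff_continuous.
  pose F x := P x - 'd P p0 x.
  have dF x : U x -> differentiable F x.
    by move=> Ux; apply: differentiableB; [exact: dP|exact: dlin].
  have : `|F q - F p| <= e * `|q - p|.
    apply: mean_value_inequality => s /seg /rP[Us Ds]; first exact: dF.
    rewrite (deriveB (diff_derivable (dP _ Us)) (diff_derivable (dlin _))).
    rewrite [X in _ - X]deriveE// diff_lin; last exact: diff_continuous.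
    by rewrite -(deriveE (q - p) dP0).
  have -> : F q - F p = P q - P p - 'd P p0 (q - p).
    rewrite [X in _ = _ - X]linearB -[LHS]/(P q - 'd P p0 q - (P p - 'd P p0 p)).
    by move: ('d P p0 q) ('d P p0 p) => y x; apply/rowP => j; rewrite !mxE; ring.
  move=> Fe; have := vk (q - p); set d := `|q - p| => dk.
  have : `|'d P p0 (q - p)| <= `|P q - P p| + e * d.
    rewrite -[X in `|X|](subrK (P q - P p)) addrC.
    apply: le_trans (ler_normD _ _) _; rewrite lerD2l -normrN opprB.
    exact: Fe.
  move=> /(ler_wpM2l (ltW k0)) /(le_trans dk).
  have -> : k * (`|P q - P p| + e * d) = k * `|P q - P p| + d / 2.
    by rewrite /e; field; exact: lt0r_neq0.
  lra.
- move=> p v /rP[Up De].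
  rewrite -[X in `|X|](subrK ('D_v P p0)) mulrDl.
  apply: le_trans (ler_normD _ _) _; rewrite lerD//.
  by rewrite deriveE.
Qed.

End local_immersion.

(** * Displacement in charts *)

Local Notation coord := Defs.coord.

Section displacement_def.
Context {R : numDomainType} {X : Type} {V : normedZmodType R}.

Definition displacement (iota : X -> V) (f : X -> X) (x : X) : V :=
  iota (f x) - iota x.

Definition displacement_lipschitz (iota : X -> V) (eta : R) (f : X -> X) :=
  forall x y, `|displacement iota f x - displacement iota f y|
              <= eta * `|iota x - iota y|.

End displacement_def.

Section chart_derivatives.
Context {R : realType} {m N : nat} {M : topologicalType}.
Variables (A : smooth_manifold R m M) (iota : M -> 'rV[R]_N).
Hypothesis iotaE : C1_embedding A iota.

Lemma embedding_chart_differentiable (f : M -> M) (i : chart A) p :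
  C1_map A f -> chart_img i p -> differentiable (iota \o f \o param i) p.
Proof.
move=> [cf df] ip; have [_ _ _ diota _] := iotaE.
pose j := chart_at A (f (param i p)).
have jp : dom j (f (param i p)) by exact: dom_chart_at.
have nU : nbhs p [set q | chart_img i q /\ dom j (f (param i q))].
  apply: open_nbhs_nbhs; split=> //.
  exact: open_chart_preimage cf (dom_open j).
have E : \forall q \near p,
    ((iota \o param j) \o (coord j \o f \o param i)) q = (iota \o f \o param i) q.
  by apply: filterS nU => q [iq jq] /=; rewrite coordK.
apply: (differentiable_near_eq E).
apply: differentiable_comp; first by have [+ _] := df i j; exact.
have [+ _] := diota j; apply; by exists (f (param i p)).
Qed.

(** [ambient_D] at a point is computed in the chart that [chart_at] selects there,
which varies with the point; this transports derivatives to a fixed chart. *)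
Lemma derive_change_chart (F : M -> 'rV[R]_N) (i c : chart A) p v :
  chart_img i p -> dom c (param i p) ->
  differentiable (F \o param c) (coord c (param i p)) ->
  'D_v (F \o param i) p =
  'D_v (coord c \o param i) p *m 'J (F \o param c) (coord c (param i p)).
Proof.
move=> ip cp dF.
have dT : differentiable (coord c \o param i) p.
  by have [+ _] := transition_smooth i c 1; apply.
have nU : nbhs p [set q | chart_img i q /\ dom c (param i q)].
  apply: open_nbhs_nbhs; split=> //.
  apply: (@open_chart_preimage _ _ _ A i id _ _ (dom_open c)).
  by move=> x; exact: cvg_id.
rewrite (@near_eq_derive _ _ _ _ ((F \o param c) \o (coord c \o param i))).
  rewrite deriveE; last exact: differentiable_comp.
  by rewrite diff_comp//= -(deriveE v dT) -deriveE// deriveEjacobian.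
by apply: filterS nU => q [iq cq] /=; rewrite coordK.
Qed.

(** [ambient_D f x] extends to the ambient space the derivative of [iota \o f]
along tangent vectors, so that the difference with the identity measures the
derivative of the displacement. *)
Lemma derive_displacement_chart (f : M -> M) (i : chart A) p v :
  C1_map A f -> chart_img i p ->
  'D_v (displacement iota f \o param i) p =
  'D_v (iota \o param i) p *m
    (ambient_D A iota f (param i p) - ambient_D A iota id (param i p)).
Proof.
move=> Cf ip; have Cid := C1_map_id A.
have df := embedding_chart_differentiable Cf ip.
have did := embedding_chart_differentiable Cid ip.
rewrite (deriveB (diff_derivable df) (diff_derivable did)).
set x := param i p; pose c := chart_at A x.
have cx : dom c x by exact: dom_chart_at.
have cp : chart_img c (coord c x) by exists x.
have dfc := embedding_chart_differentiable Cf cp.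
have didc := embedding_chart_differentiable Cid cp.
rewrite (derive_change_chart v ip cx dfc) (derive_change_chart v ip cx didc).
set w := 'D_v _ p; have [_ _ _ _ /(_ c _ cp) fJ] := iotaE.
rewrite /ambient_D -/c -mulmxBr -[iota \o id \o param c]/(iota \o param c).
set J := 'J (iota \o param c) _ in fJ *.
have JJ : J *m (J^T *m invmx (J *m J^T)) = 1%:M.
  by rewrite mulmxA mulmxV ?gram_unitmx.
by rewrite -mulmxA -mulmxBr [J *m _]mulmxA JJ mul1mx.
Qed.

End chart_derivatives.

(** * Displacements of diffeomorphisms close to the identity *)

Section uniform_lipschitz.
Context {R : realType} {m N : nat} {M : topologicalType}.
Variables (A : smooth_manifold R m M) (iota : M -> 'rV[R]_N).
Hypothesis iotaE : C1_embedding A iota.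

(** In a chart ball, which is convex, the mean value inequality bounds the
variation of the displacement by the chart distance, hence by the ambient
distance. The neighborhood and the constant do not depend on [f]. *)
Lemma displacement_locally_lipschitz (x0 : M) :
  exists2 W, nbhs x0 W & exists2 K : R, 0 <= K &
    forall f e, C1_map A f ->
      (forall x, `|ambient_D A iota f x - ambient_D A iota id x| <= e) ->
    forall x y, W x -> W y ->
      `|displacement iota f x - displacement iota f y|
      <= K * e * `|iota x - iota y|.
Proof.
pose i := chart_at A x0; pose P := iota \o param i; pose p0 := coord i x0.
have ix0 : dom i x0 by exact: dom_chart_at.
have ip0 : chart_img i p0 by exists x0.
have [_ _ _ /(_ i) PC1 /(_ i _ ip0) fJ] := iotaE.
have [r [c [K [r0 c0 rU Pbi PK]]]] :=
  immersion_local_bilipschitz (@chart_img_open _ _ _ A i) PC1 ip0 fJ.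
exists (dom i `&` coord i @^-1` ball p0 r).
  apply: filterI; first by apply: open_nbhs_nbhs; split=> //; exact: dom_open.
  by apply: coord_continuous_on => //; exact: nbhsx_ballx.
exists (N%:R * `|K| * c); first by rewrite !mulr_ge0.
move=> f e Cf De x y [ix /= rx] [iy /= ry].
have e0 : 0 <= e by apply: le_trans (De x).
pose F := displacement iota f \o param i.
have -> : displacement iota f x = F (coord i x) by rewrite /F /= coordK.
have -> : displacement iota f y = F (coord i y) by rewrite /F /= coordK.
have -> : iota x = P (coord i x) by rewrite /P /= coordK.
have -> : iota y = P (coord i y) by rewrite /P /= coordK.
set p := coord i x in rx *; set q := coord i y in ry *.
apply: (@le_trans _ _ (N%:R * `|K| * e * `|p - q|)).
  apply: mean_value_inequality => s /(ball_segment ry rx) rs.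
    have Us := rU _ rs.
    apply: differentiableB.
      exact: embedding_chart_differentiable Cf Us.
    exact: (embedding_chart_differentiable iotaE (C1_map_id A)).
  rewrite (derive_displacement_chart iotaE (p - q) Cf (rU _ rs)).
  apply: le_trans (mulmx_norm_le _ _) _.
  rewrite -!mulrA ler_wpM2l// [e * _]mulrC mulrA ler_pM//.
  by apply: le_trans (PK _ _ rs) _; rewrite ler_wpM2r// ler_norm.
have := ler_wpM2l (mulr_ge0 (mulr_ge0 (ler0n R N) (normr_ge0 K)) e0) (Pbi q p ry rx).
by move=> /le_trans; apply; rewrite le_eqVlt; apply/orP; left; apply/eqP; ring.
Qed.

(** By compactness there is a scale below which any two points of [M], measured
in the ambient space, lie in a common chart ball; it is here that [iota] has to
be a homeomorphism onto its image. Above that scale, the bound on the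
displacement itself is enough. A single parameter [K] controls the Lipschitz
constant and the inverse of the scale. *)
Lemma displacement_globally_lipschitz : compact [set: M] ->
  exists2 K : R, 0 <= K & forall f e, C1_map A f ->
    (forall x, `|displacement iota f x| <= e) ->
    (forall x, `|ambient_D A iota f x - ambient_D A iota id x| <= e) ->
    displacement_lipschitz iota (K * e) f.
Proof.
move=> /compact_near_coveringP cM.
pose Q (K : R) (x : M) := forall f e, C1_map A f ->
    (forall x, `|displacement iota f x| <= e) ->
    (forall x, `|ambient_D A iota f x - ambient_D A iota id x| <= e) ->
    forall y, `|displacement iota f x - displacement iota f y|
      <= K * e * `|iota x - iota y|.
have : \forall K \near +oo, [set: M] `<=` Q K.
  apply: (cM _ _ Q) => x0 _.
  have [W nW [K0 K00 loc]] := displacement_locally_lipschitz x0.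
  have [_ ciota homeo _ _] := iotaE.
  move: nW; rewrite nbhsE => -[W' [oW' W'x0] W'W].
  have [V oV W'V] := homeo W' oW'.
  have Vx0 : V (iota x0) by move: W'x0; rewrite W'V.
  have /nbhs_ballP[r /= r0 rV] : nbhs (iota x0) V by exact: open_nbhs_nbhs.
  have VW y : V (iota y) -> W y by move=> Vy; apply: W'W; rewrite W'V.
  have r20 : 0 < r / 2 by rewrite divr_gt0.
  exists (iota @^-1` ball (iota x0) (r / 2), [set K : R | K0 + 4 / r < K]) => /=.
    split; first by apply: ciota; exact: nbhsx_ballx.
    by apply: nbhs_pinfty_gt; exact: num_real.
  move=> [x K] /= [xr K0K] f e Cf fe De y.
  have e0 : 0 <= e by apply: le_trans (De x).
  have r40 : 0 < 4 / r by rewrite divr_gt0.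
  have K0' : K0 <= K by apply: ltW; apply: lt_trans K0K; rewrite ltrDl.
  have [yr|yr] := ltP `|iota x - iota y| (r / 2).
    apply: le_trans (loc f e Cf De x y _ _) _.
    - apply/VW/rV; apply: le_ball xr; lra.
    - apply/VW/rV; rewrite [r]splitr; apply: (ball_triangle xr).
      by rewrite -ball_normE.
    - by rewrite ler_wpM2r// ler_wpM2r.
  apply: le_trans (ler_normB _ _) _.
  apply: (@le_trans _ _ (e + e)); first by rewrite lerD.
  apply: (@le_trans _ _ (4 / r * e * (r / 2))).
    have -> // : 4 / r * e * (r / 2) = e + e by field; exact: lt0r_neq0.
  have K4 : 4 / r <= K by apply/ltW/(le_lt_trans _ K0K); rewrite lerDr.
  have K00' : 0 <= K by exact: le_trans K00 K0'.
  apply: (@le_trans _ _ (K * e * (r / 2))); last by rewrite ler_wpM2l ?mulr_ge0.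
  by rewrite ler_wpM2r ?(ltW r20)// ler_wpM2r.
move=> nQ.
have : \forall K \near +oo, 0 <= K /\ [set: M] `<=` Q K.
  apply: filterI nQ; apply: nbhs_pinfty_ge; exact: num_real.
move=> /filter_ex[K [K0 KQ]]; exists K => // f e Cf fe De x y.
exact: KQ.
Qed.

Lemma C1_dist_id_lt (f : M -> M) (e : R) :
  (C1_dist A iota f id < e%:E)%E ->
  (forall x, `|displacement iota f x| <= e) /\
  (forall x, `|ambient_D A iota f x - ambient_D A iota id x| <= e).
Proof.
rewrite /C1_dist; set s1 := ereal_sup _; set s2 := ereal_sup _ => de.
have s1P x : (`|displacement iota f x|%:E <= s1)%E.
  by apply: ereal_sup_ubound; exists x.
have s2P x : (`|ambient_D A iota f x - ambient_D A iota id x|%:E <= s2)%E.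
  by apply: ereal_sup_ubound; exists x.
have ge1 (x : M) : (0 <= s1)%E by apply: le_trans (s1P x); rewrite lee_fin.
have ge2 (x : M) : (0 <= s2)%E by apply: le_trans (s2P x); rewrite lee_fin.
split=> x; rewrite -lee_fin; apply: le_trans (ltW de).
  by apply: le_trans (s1P x) _; rewrite leeDl// ge2.
by apply: le_trans (s2P x) _; rewrite leeDr// ge1.
Qed.

End uniform_lipschitz.

(** * Composition and inverses *)

Section displacement_calculus.
Context {R : realFieldType} {X : Type} {V : normedZmodType R}.
Variable iota : X -> V.

Lemma displacement_lipschitz_le (a b : R) (f : X -> X) :
  a <= b -> displacement_lipschitz iota a f -> displacement_lipschitz iota b f.
Proof. by move=> ab fa x y; apply: le_trans (fa x y) _; rewrite ler_wpM2r. Qed.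

Lemma displacement_lipschitz_comp (a b : R) (f g : X -> X) : 0 <= a ->
  displacement_lipschitz iota a f -> displacement_lipschitz iota b g ->
  displacement_lipschitz iota (a * (1 + b) + b) (f \o g).
Proof.
move=> a0 fa gb x y.
have E z : displacement iota (f \o g) z =
    displacement iota f (g z) + displacement iota g z.
  by rewrite /displacement /= addrA subrK.
rewrite !E opprD addrACA; apply: le_trans (ler_normD _ _) _.
rewrite mulrDl lerD//; apply: le_trans (fa _ _) _.
rewrite -mulrA ler_wpM2l//.
have -> : iota (g x) - iota (g y) = (iota x - iota y) +
    (displacement iota g x - displacement iota g y).
  have Ez z : iota (g z) = iota z + displacement iota g z by rewrite addrC subrK.
  by rewrite !Ez opprD addrACA.
by apply: le_trans (ler_normD _ _) _; rewrite mulrDl mul1r lerD.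
Qed.

(** The displacement of the inverse at [x] is opposite to that of [f] at [g x],
and [g] is 2-Lipschitz as soon as [a <= 1 / 2]. *)
Lemma displacement_lipschitz_inv (a : R) (f g : X -> X) : 0 <= a <= 1 / 2 ->
  cancel g f ->
  displacement_lipschitz iota a f -> displacement_lipschitz iota (2 * a) g.
Proof.
move=> /andP[a0 a2] gK fa x y.
have E z : displacement iota g z = - displacement iota f (g z).
  by rewrite /displacement gK opprB.
have le1 := fa (g x) (g y).
rewrite !E -opprD normrN; apply: le_trans le1 _.
set d := `|iota (g x) - iota (g y)|.
have : d <= `|iota x - iota y| + a * d.
  have {1}-> : d = `|(iota x - iota y) -
      (displacement iota f (g x) - displacement iota f (g y))|.
    rewrite /displacement !gK /d; congr `|_|.
    by rewrite [X in _ = _ + X]opprB addrA subrKA opprB [RHS]addrC subrKA.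
  by apply: le_trans (ler_normB _ _) _; rewrite lerD2l.
have := ler_wpM2r (normr_ge0 (iota (g x) - iota (g y))) a2; rewrite -/d.
set e := `|iota x - iota y| => ad da.
have -> : 2 * a * e = a * (2 * e) by ring.
by rewrite ler_wpM2l//; lra.
Qed.

End displacement_calculus.

(** * The limit homomorphism *)

Lemma ultrafilter_map (T U : Type) (f : T -> U) (F : set_system T) :
  UltraFilter F -> UltraFilter (f @ F).
Proof.
move=> FU; split; first exact: fmap_proper_filter.
move=> G GF FG; apply/seteqP; split=> [B GB|B]; last exact: FG.
have [//|FnB] := in_ultra_setVsetC (f @^-1` B) FU.
have /filter_ex[y []] // : G (B `&` ~` B) by apply: filterI GB (FG _ _).
Qed.

Lemma bounded_ultrafilter_cvg (R : realType) (T : Type) (F : set_system T)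
    (u : T -> R) (C : R) :
  UltraFilter F -> (\forall t \near F, `|u t| <= C) ->
  exists l : R, u t @[t --> F] --> l.
Proof.
move=> FU uC; have : compact `[- C, C]%classic by exact: segment_compact.
rewrite compact_ultra => /(_ _ (ultrafilter_map u FU)) [].
  by apply: filterS uC => t; rewrite ler_norml /= in_itv.
by move=> l [_ ul]; exists l.
Qed.

Section limit_homomorphism.
Context {R : realType} {N : nat} {X : Type} {H G : groupType}.
Variables (iota : X -> 'rV[R]_N) (E : extension_by_Z H G).
Variable rho : nat -> G -> X -> X.
Hypothesis rho1 : forall n, rho n 1%g = id.
Hypothesis rhoM : forall n a b, rho n (a * b)%g = rho n a \o rho n b.

(** The displacement of [rho n g] becomes constant at the scale of distances:
this is the only trace of C^1-convergence to the identity that the limiting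
argument uses. *)
Definition asymptotically_flat (g : G) := forall eta : R, 0 < eta ->
  \forall n \near \oo, displacement_lipschitz iota eta (rho n g).

Let rhoVK n g : cancel (rho n g^-1%g) (rho n g).
Proof. by move=> x; rewrite -[LHS]/((rho n g \o _) x) -rhoM mulgV rho1. Qed.

Lemma generated_asymptotically_flat (S : seq G) : generates S ->
  (forall s, s \in S -> asymptotically_flat s) ->
  forall g, asymptotically_flat g.
Proof.
move=> gS iS; apply: gS iS => [|a b ia ib|a ia] eta eta0.
- near=> n => x y; rewrite rho1 /displacement !subrr normr0.
  by rewrite mulr_ge0// ltW.
(* With [c <= 1], the constant [c * (1 + c) + c] is at most [3 * c]. *)
- pose c := Num.min 1 (eta / 3).
  have c0 : 0 < c by rewrite lt_min ltr01 divr_gt0.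
  apply: filterS2 (ia c c0) (ib c c0) => n fa fb; rewrite rhoM.
  apply: displacement_lipschitz_le (displacement_lipschitz_comp (ltW c0) fa fb).
  have c1 : c <= 1 by rewrite ge_min lexx.
  have c3 : c <= eta / 3 by rewrite ge_min lexx orbT.
  nra.
- pose c := Num.min (1 / 2) (eta / 2).
  have c0 : 0 < c by rewrite lt_min !divr_gt0.
  apply: filterS (ia c c0) => n fa.
  have c12 : 0 <= c <= 1 / 2 by rewrite (ltW c0) ge_min lexx.
  apply: displacement_lipschitz_le (displacement_lipschitz_inv c12 (rhoVK n a) fa).
  have c3 : c <= eta / 2 by rewrite ge_min lexx orbT.
  lra.
Unshelve. all: by end_near. Qed.

Variables (T : seq H) (x : nat -> X) (mu : nat -> R).
Hypothesis genT : generates T.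
Hypothesis flatG : forall g, asymptotically_flat g.
Hypothesis mu_gt0 : forall n, 0 < mu n.
Hypothesis mu_max : forall n h y, h \in T ->
  `|displacement iota (rho n (ext_incl E h)) y| <= mu n.
Hypothesis mu_attained : forall n,
  exists2 h, h \in T & `|displacement iota (rho n (ext_incl E h)) (x n)| = mu n.

Let D n h := displacement iota (rho n (ext_incl E h)) (x n).

Let DM n a b : D n (a * b)%g = D n b +
  displacement iota (rho n (ext_incl E a)) (rho n (ext_incl E b) (x n)).
Proof. by rewrite /D gmulfM rhoM /displacement /= [RHS]addrC addrA subrK. Qed.

(** The error is relative to the displacement of [b], so that it still vanishes
after division by [mu n]. *)
Lemma displacement_almost_additive a b (eta : R) : 0 < eta ->
  \forall n \near \oo, `|D n (a * b)%g - (D n a + D n b)| <= eta * `|D n b|.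
Proof.
move=> eta0; apply: filterS (flatG (ext_incl E a) eta0) => n fa.
rewrite DM [D n a + _]addrC opprD addrACA subrr add0r.
exact: (fa (rho n (ext_incl E b) (x n)) (x n)).
Qed.

(** Each element of [H] is a word in the generators of a length that does not
depend on [n], and near additivity bounds its displacement by a multiple of
[mu n] that depends only on the word. *)
Lemma displacement_bounded_by_max h :
  exists2 C, 0 <= C & \forall n \near \oo, `|D n h| <= C * mu n.
Proof.
move: h; apply: genT => [|a b [C C0 Ca] [C' C'0 Cb]|a [C C0 Ca]|h hT].
- exists 0 => //; near=> n.
  by rewrite mul0r /D multiplicative1 rho1 /displacement subrr normr0.
- exists (C + 2 * C'); first by rewrite addr_ge0// mulr_ge0.
  have := displacement_almost_additive a b ltr01.
  apply: filterS3 Ca Cb => n Ca Cb; rewrite mul1r => Dab.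
  rewrite -[X in `|X|](subrK (D n a + D n b)).
  apply: le_trans (ler_normD _ _) _.
  have := ler_normD (D n a) (D n b); have := mu_gt0 n; nra.
- have half_gt0 : 0 < 1 / 2 :> R by rewrite divr_gt0.
  exists (2 * C); first by rewrite mulr_ge0.
  have := displacement_almost_additive a a^-1%g (eta := 1 / 2) half_gt0.
  apply: filterS2 Ca => n Ca; rewrite mulgV.
  have -> : D n 1%g = 0 by rewrite /D multiplicative1 rho1 /displacement subrr.
  rewrite sub0r normrN => Da.
  have : `|D n a^-1%g| <= `|D n a + D n a^-1%g| + `|D n a|.
    by rewrite -[X in `|X|](addKr (D n a)) addrC; exact: ler_normB.
  lra.
- by exists 1 => //; near=> n; rewrite mul1r; exact: mu_max.
Unshelve. all: by end_near. Qed.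

(** Conjugation by [g] moves the base point to [y]; the displacement of [h] at
[y] is at most [mu n] since this bound holds at every point. *)
Lemma displacement_conj_bounded g h : h \in T ->
  \forall n \near \oo, `|D n (ext_conj E g h)| <= 2 * mu n.
Proof.
move=> hT; apply: filterS (flatG g ltr01) => n fg.
pose y := rho n g^-1%g (x n).
have xE : x n = rho n g y by rewrite /y rhoVK.
have -> : D n (ext_conj E g h) =
    displacement iota (rho n g) (rho n (ext_incl E h) y) -
    displacement iota (rho n g) y +
    displacement iota (rho n (ext_incl E h)) y.
  rewrite /D ext_conjE !rhoM /displacement /= -/y xE.
  by apply/rowP => k; rewrite !mxE; ring.
have := fg (rho n (ext_incl E h) y) y; rewrite mul1r => fgy.
apply: le_trans (ler_normD _ _) _; rewrite mulr_natl mulr2n.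
by apply: lerD; [apply: le_trans fgy _|]; exact: mu_max.
Qed.

(** For each [n] one coordinate [j n] attains the norm [mu n]; following it makes
the limit real-valued, and nonzero on some generator since [T] is finite. *)
Lemma limit_homomorphism : exists2 phi : H1 R H,
  bounded_under_conj E T 2 phi & exists h, phi h != 0.
Proof.
have /choice[j jP] : forall n, exists j, exists2 h, h \in T & `|D n h 0 j| = mu n.
  move=> n; have [h hT hn] := mu_attained n.
  have /mx_norm_neq0[[i j] /= ij] : mx_norm (D n h) != 0.
    by rewrite -[mx_norm _]/(`|D n h|) hn gt_eqF.
  by exists j, h => //; rewrite -hn [RHS]ij (ord1 i).
have [U [UU oU]] := @ultraFilterLemma nat \oo _.
pose psi h n := D n h 0 (j n) / mu n.
have psi_le h n (C : R) : `|D n h| <= C * mu n -> `|psi h n| <= C.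
  move=> DC; rewrite normrM normfV (gtr0_norm (mu_gt0 n)) ler_pdivrMr//.
  exact: le_trans (mx_entry_le_norm _ _ _) DC.
have /choice[phi phiP] : forall h : H, exists l : R, psi h n @[n --> U] --> l.
  move=> h; have [C C0 DC] := displacement_bounded_by_max h.
  apply: (bounded_ultrafilter_cvg UU (C := C)).
  by apply: oU; apply: filterS DC => n /psi_le.
have phiM a b : phi (a * b)%g = phi a + phi b.
  apply: (cvg_unique _ (phiP (a * b)%g)); first exact: norm_hausdorff.
  have -> : psi (a * b)%g =
      (fun n => (psi (a * b)%g n - (psi a n + psi b n)) + (psi a n + psi b n)).
    by apply/funext => n; rewrite subrK.
  rewrite -[phi a + phi b]add0r; apply: cvgD; last by apply: cvgD.
  apply: cvg_trans (_ : (fun n => psi (a * b)%g n - (psi a n + psi b n)) @ \oo --> 0).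
    by move=> B BP; apply: oU.
  have [C C0 Db] := displacement_bounded_by_max b.
  apply/cvgr0Pnorm_le => e e0.
  pose eta := e / (C + 1).
  have eta0 : 0 < eta by rewrite divr_gt0// ltr_wpDl.
  apply: filterS2 Db (displacement_almost_additive a b eta0) => n Db Dab.
  have -> : psi (a * b)%g n - (psi a n + psi b n) =
      (D n (a * b)%g - (D n a + D n b)) 0 (j n) / mu n.
    by rewrite /psi !mxE; ring.
  rewrite normrM normfV (gtr0_norm (mu_gt0 n)) ler_pdivrMr//.
  apply: le_trans (mx_entry_le_norm _ _ _) _; apply: le_trans Dab _.
  apply: le_trans (ler_wpM2l (ltW eta0) Db) _.
  rewrite mulrA ler_wpM2r ?(ltW (mu_gt0 n))// /eta.
  by rewrite mulrAC ler_pdivrMr ?ltr_wpDl// ler_wpM2l ?(ltW e0)// lerDl.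
have homphi : phi \in @hom_pred R H by apply/asboolP.
exists {| H1_fun := phi; H1_hom := homphi |} => [g h hT|] /=.
  rewrite leNgt; apply/negP => phi2.
  have gt2 : \forall n \near U, 2 < `|psi (ext_conj E g h) n|.
    exact: (cvgr_norm_gt _ (phiP (ext_conj E g h))).
  have le2 : \forall n \near U, `|psi (ext_conj E g h) n| <= 2.
    by apply: oU; apply: filterS (displacement_conj_bounded g hT) => n /psi_le.
  have : \forall n \near U, False.
    by apply: filterS2 gt2 le2 => n n2; rewrite leNgt n2.
  by move=> /filter_ex[].
apply: contrapT => phi0.
have : \forall n \near U, forall k : 'I_(size T), `|psi (nth 1%g T k) n| < 1.
  apply: (@filter_forall _ _ (fun (k : 'I_(size T)) n => `|psi (nth 1%g T k) n| < 1) U _).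
  move=> k; apply: (cvgr_norm_lt _ (phiP (nth 1%g T k))).
  have -> : phi (nth 1%g T k) = 0; last by rewrite normr0.
  by apply: contrapT => /eqP phik; apply: phi0; exists (nth 1%g T k).
move=> /filter_ex[n small]; have [h hT hn] := jP n.
have hk : (index h T < size T)%N by rewrite index_mem.
have := small (Ordinal hk).
by rewrite /= nth_index// /psi normrM normfV (gtr0_norm (mu_gt0 n)) hn divff ?gt_eqF// ltxx.
Qed.

End limit_homomorphism.

(** * Small representations are trivial on the subgroup *)

Lemma seq_argmax (R : realDomainType) (I : eqType) (s : seq I) (F : I -> R) :
  s != [::] -> exists2 i, i \in s & forall j, j \in s -> F j <= F i.
Proof.
elim: s => [//|a s IHs] _; have [->|s0] := eqVneq s [::].
  by exists a; rewrite ?mem_head// => j; rewrite inE => /eqP ->.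
have [i si imax] := IHs s0; have [ai|ia] := leP (F a) (F i).
  exists i; first by rewrite inE si orbT.
  by move=> j; rewrite inE => /orP[/eqP ->//|/imax].
exists a; first exact: mem_head.
move=> j; rewrite inE => /orP[/eqP ->//|/imax ji].
exact: le_trans ji (ltW ia).
Qed.

Lemma Hom_dist_lt (R : realType) (m N : nat) (M : topologicalType)
    (A : smooth_manifold R m M) (iota : M -> 'rV[R]_N) (G : groupType)
    (S : seq G) (rho rho' : {multiplicative G -> Diff1 A}) (e : \bar R) s :
  (Hom_dist iota S rho rho' < e)%E -> s \in S ->
  (C1_dist A iota (rho s) (rho' s) < e)%E.
Proof.
move=> He sS; apply: le_lt_trans He; rewrite /Hom_dist.
elim: S sS => [//|a S IHS]; rewrite inE big_cons le_max => /orP[/eqP ->|/IHS ->].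
  by rewrite lexx.
by rewrite orbT.
Qed.

Lemma displacement_max (R : realType) (N : nat) (M : topologicalType)
    (iota : M -> 'rV[R]_N) (f : M -> M) :
  compact [set: M] -> continuous iota -> continuous f -> M ->
  exists x, forall y, `|displacement iota f y| <= `|displacement iota f x|.
Proof.
move=> cM ci cf x0.
have [|||x _ xmax] := @compact_EVT_max M R (fun x => `|displacement iota f x|) setT.
- by exists x0.
- exact: cM.
- apply: continuous_subspaceT => x.
  apply: (@cvg_norm _ _ _ (nbhs x)); apply: cvgB; last exact: ci.
  by apply: continuous_comp; [exact: cf|exact: ci].
- by exists x => y; apply: xmax; rewrite inE.
Qed.

Lemma nontrivial_generator (G H : groupType) (T : seq H)
    (f : H -> G) : (forall a b, f (a * b)%g = (f a * f b)%g) -> generates T ->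
  (exists h, f h != 1%g) -> exists2 h, h \in T & f h != 1%g.
Proof.
move=> fM gT [h]; apply: contra_neqP => nT.
have f1 : f 1%g = 1%g by apply: (mulgI (f 1%g)); rewrite -fM !mulg1.
move: h; apply: gT => // [x y fx fy|x fx|h hT].
- by rewrite fM fx fy mulg1.
- by apply: (mulgI (f x)); rewrite -fM mulgV f1 fx mulg1.
- by apply: contrapT => /eqP fh; apply: nT; exists h.
Qed.

Theorem theorem1p1 (R : realType) (m N : nat) (M : topologicalType)
    (A : smooth_manifold R m M) (g : riemannian_metric A)
    (iota : M -> 'rV[R]_N) (H G : groupType) (E : extension_by_Z H G)
    (S : seq G) (t : G) :
  compact [set: M] ->
  C1_embedding A iota ->
  finitely_generated H ->
  generates S ->
  ext_proj E t = 1 \/ ext_proj E t = -1 ->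
  hyperbolic (conj_pullback R E t) ->
  exists U : set {multiplicative G -> Diff1 A},
    Hom_neighborhood iota S (trivial_rep G (Diff1 A)) U /\
    forall rho, U rho -> forall h : H, rho (ext_incl E h) = 1%g.
Proof.
move=> cM iotaE [T gT] gS _ hyp.
pose B (e : R) := [set rho : {multiplicative G -> Diff1 A} |
  (Hom_dist iota S rho (trivial_rep G (Diff1 A)) < e%:E)%E].
have [[e e0 eB]|nB] := pselect (exists2 e : R, 0 < e &
    forall rho, B e rho -> forall h : H, rho (ext_incl E h) = 1%g).
  by exists (B e); split=> //; exists e.
exfalso.
have [iotaI ciota _ _ _] := iotaE.
have nontriv n : exists rho, B (n.+1%:R^-1) rho /\
    exists2 h, h \in T & rho (ext_incl E h) != 1%g.
  apply: contrapT => nrho; apply: nB; exists n.+1%:R^-1; first by rewrite invr_gt0.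
  move=> rho Brho h; apply: contrapT => /eqP rhoh; apply: nrho.
  exists rho; split=> //.
  apply: (@nontrivial_generator _ _ T (fun h => rho (ext_incl E h))) => //.
    by move=> a b; rewrite !gmulfM.
  by exists h.
have /choice[rho rhoP] := nontriv.
have max_exists n : exists xh : M * H, xh.2 \in T /\
    let d := `|displacement iota (rho n (ext_incl E xh.2)) xh.1| in
    0 < d /\ forall h y, h \in T ->
      `|displacement iota (rho n (ext_incl E h)) y| <= d.
  have [_ [h0 h0T rhoh0]] := rhoP n.
  have [x0 x0P] : exists x, rho n (ext_incl E h0) x != x.
    apply: contrapT => nx; move/eqP: rhoh0; apply; apply: diff1_ext.
    apply/funext => x; apply: contrapT => /eqP rx; apply: nx.
    by exists x.
  have xmax h : exists x, forall y,
      `|displacement iota (rho n (ext_incl E h)) y| <=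
      `|displacement iota (rho n (ext_incl E h)) x|.
    have [cf _] := diff1_fun_C1 (rho n (ext_incl E h)).
    exact: (displacement_max cM ciota cf x0).
  have /choice[x xP] := xmax.
  have T0 : T != [::] by case: (T) h0T.
  have [h hT hmax] := seq_argmax
    (fun h => `|displacement iota (rho n (ext_incl E h)) (x h)|) T0.
  have dmax h' y : h' \in T -> `|displacement iota (rho n (ext_incl E h')) y| <=
      `|displacement iota (rho n (ext_incl E h)) (x h)|.
    by move=> h'T; exact: le_trans (xP h' y) (hmax h' h'T).
  exists (x h, h); split=> //=; split=> [|h' y]; last exact: dmax.
  apply: lt_le_trans (dmax h0 x0 h0T); rewrite normr_gt0 subr_eq0.
  by apply: contra x0P => /eqP/iotaI ->.
have /choice[xh xhP] := max_exists.
pose act n (a : G) : M -> M := rho n a.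
have [K K0 KP] := displacement_globally_lipschitz iotaE cM.
have [|||||||phi bphi [h /eqP phih]] :=
    @limit_homomorphism R N M H G iota E act _ _ T (fun n => (xh n).1)
      (fun n => `|displacement iota (rho n (ext_incl E (xh n).2)) (xh n).1|).
- by move=> n; rewrite /act multiplicative1.
- by move=> n a b; rewrite /act gmulfM.
- exact: gT.
- move=> a; apply: generated_asymptotically_flat gS _ _.
  + by move=> n; rewrite /act multiplicative1.
  + by move=> n b c; rewrite /act gmulfM.
  + move=> s sS eta eta0.
    have c0 : 0 < eta / (K + 1) by rewrite divr_gt0// ltr_wpDl.
    apply: filterS (near_infty_natSinv_lt (PosNum c0)) => n /= nc.
    have [Bn _] := rhoP n.
    have [De DDe] := C1_dist_id_lt (Hom_dist_lt Bn sS).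
    apply: displacement_lipschitz_le (KP _ _ (diff1_fun_C1 (rho n s)) De DDe).
    apply: le_trans (ler_wpM2l K0 (ltW nc)) _.
    by rewrite mulrCA ler_piMr ?(ltW eta0)// ler_pdivrMr ?ltr_wpDl// mul1r lerDl.
- by move=> n; have [_ []] := xhP n.
- by move=> n h y hT; have [_ [_]] := xhP n; apply.
- by move=> n; have [hT _] := xhP n; exists (xh n).2.
exact: phih (hyperbolic_bounded_eq0 gT hyp bphi h).
Qed.
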